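(* Let $\Sigma=(X,X_{fr},\widetilde B)$ and $\Sigma'$ be seeds. Then $\mathcal A(\Sigma')$ is a proper rooted cluster subalgebra of $\mathcal A(\Sigma)$ if and only if there exist $I'\subseteq X$ and $\emptyset\neq I_1\subseteq\widetilde X$ such that the $I'\times I_1$ sub-matrix of the diagonal-unitization matrix $U\widetilde B$ is a zero matrix and $\Sigma'\cong\Sigma_{I_0,I_1}$ (isomorphism of seeds) with $I_0=X\setminus(I'\cup I_1)$. In particular: (i) a proper rooted cluster subalgebra $\mathcal A(\Sigma')$ of $\mathcal A(\Sigma)$ is trivial if and only if it can be written (up to isomorphism) as $\mathcal A(\Sigma_{I_0,I_1})$ with $I_0=X\setminus I_1$ and $I_1\ne\emptyset$; (ii) all proper rooted cluster subalgebras of $\mathcal A(\Sigma)$ are trivial if and only if all entries of $U\widetilde B$ are nonzero; in this case there are no non-trivial proper rooted cluster subalgebras.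
   Context: **Seeds and cluster algebras.** A seed $\Sigma=(X,X_{fr},\widetilde B)$ consists of disjoint finite sets $X=\{x_1,\dots,x_n\}$ (the cluster; its elements are exchangeable variables; $X=\emptyset$ is allowed) and $X_{fr}=\{x_{n+1},\dots,x_{n+m}\}$ (frozen variables) such that the extended cluster $\widetilde X=X\cup X_{fr}$ is algebraically independent over $\mathbb Q$ and generates the field $\mathbb F(\Sigma)=\mathbb Q(\widetilde X)$, together with an integer matrix $\widetilde B=(b_{xy})_{x\in X,y\in\widetilde X}$ whose principal part $B=(b_{xy})_{x,y\in X}$ is totally sign-skew-symmetric: every matrix obtained from it by finitely many mutations is sign-skew-symmetric (for all $x,y$, either $b_{xy}=b_{yx}=0$ or $b_{xy}b_{yx}<0$). For $x\in X$ the mutation $\mu_x(\Sigma)$ replaces $x$ by $\mu_x(x)=x^{-1}\bigl(\prod_{b_{xt}>0}t^{b_{xt}}+\prod_{b_{xt}<0}t^{-b_{xt}}\bigr)$ ($t\in\widetilde X$), fixes the other variables ($\mu_x(y)=y$ for $y\ne x$), and replaces $\widetilde B$ by the matrix with entries $-b_{yz}$ if $y=x$ or $z=x$, and $b_{yz}+\frac{|b_{yx}|b_{xz}+b_{yx}|b_{xz}|}{2}$ otherwise (relabelling $x$ as $\mu_x(x)$). $\mathcal A(\Sigma)$ is the $\mathbb Z[X_{fr}]$-subalgebra of $\mathbb F(\Sigma)$ generated by all cluster variables in all seeds obtained from $\Sigma$ by iterated mutations; together with its initial seed $\Sigma$ it is called a rooted cluster algebra. It is trivial if it has no exchangeable cluster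 variables ($X=\emptyset$), non-trivial otherwise. **Seed isomorphisms, sub-seeds.** Pairs $(x,y),(z,w)$ with $x,z\in X$, $y,w\in\widetilde X$ are adjacent if $b_{xz}\neq0$ or $x=z$. A seed homomorphism $f:\Sigma\to\Sigma'$ is a map $f:\widetilde X\to\widetilde X'$ with $f(X)\subseteq X'$ such that for all adjacent pairs $(x,y),(z,w)$: $(b'_{f(x)f(y)}b_{xy})(b'_{f(z)f(w)}b_{zw})\ge0$ and $|b'_{f(x)f(y)}|\ge|b_{xy}|$; it is a seed isomorphism if it induces bijections $X\to X'$, $\widetilde X\to\widetilde X'$ and $|b_{xy}|=|b'_{f(x)f(y)}|$ for all $x\in X,y\in\widetilde X$. For $I_0\subseteq X$, $I_1\subseteq\widetilde X$, $I_0\cap I_1=\emptyset$, $\Sigma_{I_0,I_1}=(X\setminus(I_0\cup I_1),(X_{fr}\cup I_0)\setminus I_1,\widetilde B')$, with $\widetilde B'$ the restriction of $\widetilde B$ to rows $X\setminus(I_0\cup I_1)$ and columns $\widetilde X\setminus I_1$. **Rooted cluster subalgebras.** A sequence $(y_1,\dots,y_l)$ is $\Sigma$-admissible if $y_1$ is exchangeable in $\Sigma$ and $y_i$ is exchangeable in $\mu_{y_{i-1}}\cdots\mu_{y_1}(\Sigma)$ for $i\ge2$; it is $(f,\Sigma,\Sigma')$-biadmissible if moreover $(f(y_1),\dots,f(y_l))$ is $\Sigma'$-admissible. A rooted cluster morphism $f:\mathcal A(\Sigma)\to\mathcal A(\Sigma')$ is a unital ring homomorphism with (CM1) $f(\widetilde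 X)\subseteq\widetilde X'\sqcup\mathbb Z$; (CM2) $f(X)\subseteq X'\sqcup\mathbb Z$; (CM3) $f(\mu_{y_s}\cdots\mu_{y_1}(y))=\mu_{f(y_s)}\cdots\mu_{f(y_1)}(f(y))$ for every $(f,\Sigma,\Sigma')$-biadmissible sequence and every $y\in\widetilde X$ (mutations fix integers). An isomorphism is an injective and surjective rooted cluster morphism. $\mathcal A(\Sigma')$ is a rooted cluster subalgebra of $\mathcal A(\Sigma)$ if there is an injective rooted cluster morphism $\mathcal A(\Sigma')\to\mathcal A(\Sigma)$. It is a pure cluster subalgebra if $\Sigma'\cong\Sigma_{I_0,\emptyset}$ for some $I_0\subseteq X$. A rooted cluster subalgebra is proper if it is not a pure cluster subalgebra. **Diagonal-unitization matrix.** $U\widetilde B=(c_{xy})_{x\in X,y\in\widetilde X}$ with $c_{xy}=b_{xy}$ for $x\ne y$ and $c_{xx}=1$. A sub-matrix whose row-index set or column-index set is empty is regarded as a zero matrix. *)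

(* Defs.v *)
From HB Require Import structures.
From mathcomp Require Import all_boot all_order all_algebra.
From mathcomp Require Import finmap mpoly.

Set Implicit Arguments.
Unset Strict Implicit.
Unset Printing Implicit Defensive.

Import Order.TTheory GRing.Theory Num.Theory.
Local Open Scope fset_scope.
Local Open Scope ring_scope.

Section Seeds.
Variable F : fieldType.
Implicit Types (A : {fset F}) (x y z t a b : F) (s : seq F).

(* The numerator below is always even, so that its Euclidean quotient by 2 is
   exact. *)
Definition mutate_mx (T : eqType) (k : T) (B : T -> T -> int) : T -> T -> int :=
  fun i j =>
    if (i == k) || (j == k) then - B i j
    else B i j + ((`|B i k| * B k j + B i k * `|B k j|) %/ 2)%Z.

Definition sign_skew_symmetric A (B : F -> F -> int) : Prop :=
  {in A &, forall x y, (B x y = 0 /\ B y x = 0) \/ B x y * B y x < 0}.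

(* The labels of the rows and columns are kept fixed under mutation here. *)
Definition totally_sign_skew_symmetric A (B : F -> F -> int) : Prop :=
  forall s, {subset s <= A} ->
    sign_skew_symmetric A (foldl (fun C k => mutate_mx k C) B s).

(* Algebraic independence over Q; the ambient field has characteristic 0
   wherever this is used, so that [ratr] is the embedding of Q. *)
Definition algebraically_independent A : Prop :=
  forall p : {mpoly rat[#|` A|]},
    p != 0 -> mmap ratr (fun i : 'I_#|` A| => nth 0 A i) p != 0.

(* The data of a seed; the axioms are in [is_seed]. The variables are elements
   of an ambient field F which may be larger than the field F(Sigma)
   generated by the extended cluster: this lets Sigma, its mutations and the
   seeds Sigma_{I0,I1} live in the same F, and A(Sigma), being contained in
   F(Sigma), does not depend on F. Only the values of [exmx] on
   exch x extended are meaningful. *)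
Record seed := Seed {
  exch : {fset F};
  frozen : {fset F};
  exmx : F -> F -> int
}.

Definition extended (S : seed) : {fset F} := exch S `|` frozen S.

Record is_seed (S : seed) : Prop := IsSeed {
  seed_char0 : [pchar F] =i pred0;
  seed_disjoint : [disjoint exch S & frozen S];
  seed_indep : algebraically_independent (extended S);
  seed_tsss : totally_sign_skew_symmetric (exch S) (exmx S)
}.

Definition exchanged (S : seed) x : F :=
  x^-1 * (\prod_(t <- extended S | (0 < exmx S x t)%R) t ^+ `|exmx S x t|%N
          + \prod_(t <- extended S | (exmx S x t < 0)%R) t ^+ `|exmx S x t|%N).

Definition mutate_var (S : seed) x y : F :=
  if y == x then exchanged S x else y.

(* [old] undoes the relabelling of x as its exchanged variable. *)
Definition mutate (S : seed) x : seed :=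
  let old z := if z == exchanged S x then x else z in
  Seed (exchanged S x |` (exch S `\ x)) (frozen S)
       (fun y z => mutate_mx x (exmx S) (old y) (old z)).

Fixpoint admissible (S : seed) s : bool :=
  if s is x :: s' then (x \in exch S) && admissible (mutate S x) s' else true.

Definition mutate_seq (S : seed) s : seed := foldl mutate S s.

Fixpoint mutate_var_seq (S : seed) s y : F :=
  if s is x :: s' then mutate_var_seq (mutate S x) s' (mutate_var S x y) else y.

Definition cluster_variable (S : seed) z : Prop :=
  exists s, admissible S s /\ z \in exch (mutate_seq S s).

(* The Z[X_fr]-subalgebra generated by the cluster variables is the subring
   generated by the frozen and the cluster variables. *)
Inductive cluster_algebra (S : seed) : F -> Prop :=
| ca_one : cluster_algebra S 1
| ca_frozen x : x \in frozen S -> cluster_algebra S x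
| ca_cluster x : cluster_variable S x -> cluster_algebra S x
| ca_sub a b : cluster_algebra S a -> cluster_algebra S b ->
    cluster_algebra S (a - b)
| ca_mul a b : cluster_algebra S a -> cluster_algebra S b ->
    cluster_algebra S (a * b).

Definition trivial (S : seed) : Prop := exch S = fset0.

(* Sigma_{I0,I1}; restricting the matrix amounts to shrinking the index sets. *)
Definition sub_seed (S : seed) (I0 I1 : {fset F}) : seed :=
  Seed (exch S `\` (I0 `|` I1)) ((frozen S `|` I0) `\` I1) (exmx S).

Definition diag_unitization (S : seed) : F -> F -> int :=
  fun x y => if x == y then 1 else exmx S x y.

Definition is_integer a : Prop := exists n : int, a = n%:~R.

End Seeds.

Section Morphisms.
Variables F F' : fieldType.
Implicit Types (S : seed F) (f : F -> F').

Definition adjacent S (x z : F) : Prop := exmx S x z <> 0 \/ x = z.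

(* Maps defined on a subset of F are represented by functions on F whose values
   outside of that subset are irrelevant. *)
Record seed_hom S (S' : seed F') f : Prop := SeedHom {
  sh_extended : {in extended S, forall x, f x \in extended S'};
  sh_exch : {in exch S, forall x, f x \in exch S'};
  sh_sign : forall x y z w,
    x \in exch S -> y \in extended S -> z \in exch S -> w \in extended S ->
    adjacent S x z ->
    0 <= (exmx S' (f x) (f y) * exmx S x y) * (exmx S' (f z) (f w) * exmx S z w);
  (* every pair (x, y) is adjacent to itself *)
  sh_abs : {in exch S & extended S, forall x y,
    `|exmx S x y| <= `|exmx S' (f x) (f y)|}
}.

Record seed_iso S (S' : seed F') f : Prop := SeedIso {
  si_hom : seed_hom S S' f;
  si_inj : {in extended S &, injective f};
  si_extended : f @` extended S = extended S';
  si_exch : f @` exch S = exch S';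
  si_abs : {in exch S & extended S, forall x y,
    `|exmx S x y| = `|exmx S' (f x) (f y)|}
}.

Definition seed_isomorphic S (S' : seed F') : Prop := exists f, seed_iso S S' f.

Definition biadmissible f S (S' : seed F') (s : seq F) : bool :=
  admissible S s && admissible S' [seq f y | y <- s].

Record rooted_cluster_morphism S (S' : seed F') f : Prop := RootedClusterMorphism {
  rcm_codom : forall a, cluster_algebra S a -> cluster_algebra S' (f a);
  rcm_one : f 1 = 1;
  rcm_add : forall a b, cluster_algebra S a -> cluster_algebra S b ->
    f (a + b) = f a + f b;
  rcm_mul : forall a b, cluster_algebra S a -> cluster_algebra S b ->
    f (a * b) = f a * f b;
  rcm_CM1 : forall x, x \in extended S ->
    f x \in extended S' \/ is_integer (f x);
  rcm_CM2 : forall x, x \in exch S -> f x \in exch S' \/ is_integer (f x);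
  (* integers are not variables, so [mutate_var_seq] fixes them *)
  rcm_CM3 : forall s y, biadmissible f S S' s -> y \in extended S ->
    f (mutate_var_seq S s y) = mutate_var_seq S' [seq f x | x <- s] (f y)
}.

Definition injective_on_algebra S f : Prop :=
  forall a b, cluster_algebra S a -> cluster_algebra S b -> f a = f b -> a = b.

Definition surjective_on_algebra S (S' : seed F') f : Prop :=
  forall c, cluster_algebra S' c -> exists2 a, cluster_algebra S a & f a = c.

Definition rooted_cluster_isomorphic S (S' : seed F') : Prop :=
  exists f, [/\ rooted_cluster_morphism S S' f, injective_on_algebra S f
              & surjective_on_algebra S S' f].

(* A(S) is a rooted cluster subalgebra of A(S') *)
Definition rooted_cluster_subalgebra S (S' : seed F') : Prop :=
  exists f, rooted_cluster_morphism S S' f /\ injective_on_algebra S f.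

Definition pure_cluster_subalgebra S (S' : seed F') : Prop :=
  exists2 I0 : {fset F'}, I0 `<=` exch S' &
    seed_isomorphic S (sub_seed S' I0 fset0).

Definition proper_cluster_subalgebra S (S' : seed F') : Prop :=
  rooted_cluster_subalgebra S S' /\ ~ pure_cluster_subalgebra S S'.

End Morphisms.

(* Main.v *)
(* A rooted cluster embedding f is determined on the initial extended cluster,
   where it is injective. Applying (CM3) to a single mutation and comparing the
   exchange relations of x and f x shows that row f x of the matrix of S is, up
   to a sign, row x of the matrix of S' extended by zeros; this is exactly an
   isomorphism onto some S_{I0,I1} with a vanishing I' x I1 block. Conversely,
   such an isomorphism extends to an isomorphism of fields of rational
   functions, and the relation "the rows agree up to signs that are constant on
   connected components, and vanish outside the image" is preserved by
   mutation.

   Algebraic independence is used through evaluations: any positive rational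
   values of the extended cluster extend to the rational functions defined
   there, and this property is inherited by all mutated seeds. At the point
   (1,...,1) every exchanged variable takes the value 2, so it is a new element;
   at points with coordinates 1 and 2 the exchange relations read off the
   absolute values and the relative signs of the matrix entries. *)

Require Import Defs.
From HB Require Import structures.
From mathcomp Require Import all_boot all_order all_algebra.
From mathcomp Require Import finmap mpoly.
From mathcomp Require Import ring.
From Stdlib Require ClassicalEpsilon.
Set Implicit Arguments.
Unset Strict Implicit.
Unset Printing Implicit Defensive.

Import Order.TTheory GRing.Theory Num.Theory.
Local Open Scope fset_scope.
Local Open Scope ring_scope.

(** * Rational constants in characteristic 0 and algebraically independent families *)

Lemma intr_eq0_pchar0 (F : fieldType) (n : int) :
  [pchar F] =i pred0 -> (n%:~R == 0 :> F) = (n == 0).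
Proof.
move/pcharf0P=> hF; case: n => n; first exact: hF.
by rewrite NegzE mulrNz !oppr_eq0; apply: hF.
Qed.

Lemma ratr_divz (F : fieldType) (a b : int) :
  [pchar F] =i pred0 -> b != 0 -> ratr (a%:~R / b%:~R) = a%:~R / b%:~R :> F.
Proof.
move=> hF b0; set x : rat := a%:~R / b%:~R.
apply/eqP; rewrite /ratr eqr_div ?intr_eq0_pchar0 ?denq_eq0 // -!intrM.
suff -> : numq x * b = a * denq x by [].
apply: (@intr_inj rat); rewrite !intrM numqE /x mulrAC mulfVK ?intr_eq0 //.
Qed.

(** In positive characteristic a denominator can vanish in [F], and [ratr] is then not additive. The
    bundled [r] gives access to morphism lemmas for [mmap]. *)
Lemma ratr_rmorphism (F : fieldType) :
  [pchar F] =i pred0 -> exists r : {rmorphism rat -> F}, r =1 ratr.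
Proof.
move=> hF.
have nzF (n : int) : n != 0 -> n%:~R != 0 :> F by rewrite intr_eq0_pchar0.
have ratrB : zmod_morphism (@ratr F).
  move=> x y; rewrite -{1}(divq_num_den x) -{1}(divq_num_den y).
  rewrite -mulNr addf_div ?intr_eq0 ?denq_eq0 // -!intrM -!rmorphN -!intrM -intrD.
  rewrite ratr_divz // ?mulf_neq0 ?denq_eq0 // intrD !intrM mulrNz.
  by rewrite -addf_div ?nzF ?denq_eq0 // mulNr.
have ratrM : monoid_morphism (@ratr F).
  split=> [|x y]; first by rewrite /ratr divr1.
  rewrite -{1}(divq_num_den x) -{1}(divq_num_den y) mulf_div -!intrM.
  by rewrite ratr_divz // ?mulf_neq0 ?denq_eq0 // !intrM -mulf_div.
pose fA := GRing.isZmodMorphism.Build rat F (@ratr F) ratrB.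
pose fM := GRing.isMonoidMorphism.Build rat F (@ratr F) ratrM.
by exists (HB.pack_for {rmorphism rat -> F} (@ratr F) fA fM).
Qed.

Lemma rmorph_mmap (n : nat) (R : nzRingType) (A B : nzRingType)
    (f : R -> A) (h : 'I_n -> A) (g : {rmorphism A -> B}) (p : {mpoly R[n]}) :
  g (mmap f h p) = mmap (g \o f) (g \o h) p.
Proof.
rewrite /mmap rmorph_sum; apply: eq_bigr => m _; rewrite rmorphM /mmap1.
by rewrite rmorph_prod; congr (_ * _); apply: eq_bigr => i _; rewrite rmorphXn.
Qed.

Lemma eq_mmap (n : nat) (R A : nzRingType) (f f' : R -> A) (h h' : 'I_n -> A) :
  f =1 f' -> h =1 h' -> mmap f h =1 mmap f' h'.
Proof.
move=> ef eh p; apply: eq_bigr => m _; rewrite ef; congr (_ * _).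
exact: mmap1_eq.
Qed.

(** The variables of [p] are renamed by the position of [v i] in [B]. The renaming [g] has the left
    inverse [d], so [g p] is again nonzero, and it has the same value. *)
Lemma algebraically_independent_family (F : fieldType) (B : {fset F}) (n : nat)
    (v : 'I_n -> F) :
  [pchar F] =i pred0 -> algebraically_independent B -> injective v ->
  (forall i, v i \in B) ->
  forall p : {mpoly rat[n]}, p != 0 -> mmap ratr v p != 0.
Proof.
move=> /ratr_rmorphism [r er] hB v_inj vB p.
have iB i : (index (v i) B < #|` B|)%N by rewrite index_mem; apply: vB.
pose c i := Ordinal (iB i).
have c_inj : injective c.
  move=> i j /(congr1 val) /= e; apply: v_inj.
  by rewrite -[LHS](nth_index 0 (vB i)) e nth_index //; exact: vB.
pose g := mmap (@mpolyC #|` B| _) (fun i => 'X_(c i) : {mpoly rat[#|` B|]}).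
pose d j : {mpoly rat[n]} := if [pick i | c i == j] is Some i then 'X_i else 0.
have dK : mmap (@mpolyC n _) d (g p) = p.
  rewrite /g (rmorph_mmap _ _ (mmap (@mpolyC n _) d)).
  rewrite -[RHS]comp_mpoly_id /comp_mpoly; apply: eq_mmap => [a|i] /=.
    exact: mmapC.
  rewrite mmapX mmap1U /d tnth_mktuple; case: pickP => [j /eqP/c_inj -> //|/(_ i)].
  by rewrite eqxx.
have gE : mmap ratr (fun i : 'I_#|` B| => nth 0 B i) (g p) = mmap ratr v p.
  rewrite -(eq_mmap er (frefl _)) /g (rmorph_mmap _ _ (mmap r _)).
  apply: eq_mmap => [a|i] /=; first by rewrite mmapC; exact: er.
  by rewrite mmapX mmap1U nth_index //; exact: vB.
move=> p_neq0; rewrite -gE; apply: hB; apply: contraNneq p_neq0 => g0.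
by rewrite -dK g0 mmap0.
Qed.

Lemma mmap_zero (n : nat) (R S : nzRingType) (f : R -> S) (h : 'I_n -> S) :
  mmap f h 0 = 0.
Proof. by rewrite /mmap msupp0 big_nil. Qed.

(** * Values of rational expressions at a point *)

(** A relation, because different expressions for one element may a priori have different values.
    The condition in [ev_inv] excludes a real conflict: as [0^-1 = 0], inverting [x - y] where
    [w x = w y] would give [1 = (x - y) / (x - y)] the value 0. *)
Inductive evaluates (F L : fieldType) (A : {fset F}) (w : F -> L) : F -> L -> Prop :=
| ev_var x : x \in A -> evaluates A w x (w x)
| ev_one : evaluates A w 1 1
| ev_sub a b c d : evaluates A w a b -> evaluates A w c d ->
    evaluates A w (a - c) (b - d)
| ev_mul a b c d : evaluates A w a b -> evaluates A w c d ->
    evaluates A w (a * c) (b * d)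
| ev_inv a b : b != 0 -> evaluates A w a b -> evaluates A w a^-1 b^-1.

Section Evaluation.
Variables (F L : fieldType) (A : {fset F}) (w : F -> L).
Hypotheses (hF : [pchar F] =i pred0) (hL : [pchar L] =i pred0).
Hypothesis hA : algebraically_independent A.

Lemma ev_zero : evaluates A w 0 0.
Proof. by rewrite -(subrr (1 : F)) -(subrr (1 : L)); apply: ev_sub; apply: ev_one. Qed.

Lemma ev_add a b c d :
  evaluates A w a b -> evaluates A w c d -> evaluates A w (a + c) (b + d).
Proof.
move=> ab cd; rewrite -[c]opprK -[d]opprK -(sub0r c) -(sub0r d).
by apply: ev_sub => //; apply: ev_sub => //; apply: ev_zero.
Qed.

Lemma ev_exp a b n : evaluates A w a b -> evaluates A w (a ^+ n) (b ^+ n).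
Proof.
by move=> ab; elim: n => [|n IH]; rewrite ?expr0 ?exprS; [apply: ev_one|apply: ev_mul].
Qed.

Lemma ev_prod (I : eqType) (s : seq I) (P : pred I) (g : I -> F) (h : I -> L) :
  {in s, forall i, P i -> evaluates A w (g i) (h i)} ->
  evaluates A w (\prod_(i <- s | P i) g i) (\prod_(i <- s | P i) h i).
Proof.
move=> gh; rewrite 2!(big_seq_cond P).
by apply: (big_rec2 (evaluates A w)) => [|i b c /andP[si Pi]];
  [apply: ev_one|apply: ev_mul; apply: gh].
Qed.

Lemma ev_nat n : evaluates A w n%:R n%:R.
Proof.
elim: n => [|n IH]; first exact: ev_zero.
by rewrite -!natr1; apply: ev_add IH _; apply: ev_one.
Qed.

Lemma ev_int (n : int) : evaluates A w n%:~R n%:~R.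
Proof.
case: n => n; first exact: ev_nat.
rewrite NegzE !mulrNz -(sub0r (_ *~ _)) -[- (_ *~ _) in X in evaluates _ _ _ X]sub0r.
by apply: ev_sub; [apply: ev_zero|apply: ev_nat].
Qed.

Let ev (K : fieldType) (h : F -> K) (p : {mpoly rat[#|` A|]}) :=
  mmap ratr (fun i : 'I_#|` A| => h (nth 0 A i)) p.

(** Induction on the expression, with one pair [p], [q] serving in both fields. Only the value of
    [q] at [w] has to be nonzero: independence then makes [q] nonzero in [F]. *)
Lemma ev_fraction a b : evaluates A w a b ->
  exists p q, [/\ ev w q != 0, a * ev id q = ev id p & b * ev w q = ev w p].
Proof.
have [r er] := ratr_rmorphism hF; have [r' er'] := ratr_rmorphism hL.
pose e1 : {rmorphism {mpoly rat[#|` A|]} -> F} := mmap r (fun i => nth 0 A i).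
pose e2 : {rmorphism {mpoly rat[#|` A|]} -> L} := mmap r' (fun i => w (nth 0 A i)).
have E1 : ev id =1 e1 by apply: eq_mmap => // x; rewrite er.
have E2 : ev w =1 e2 by apply: eq_mmap => // x; rewrite er'.
move=> h; suff: exists p q, [/\ e2 q != 0, a * e1 q = e1 p & b * e2 q = e2 p].
  by move=> [p [q ?]]; exists p, q; rewrite !E1 !E2.
elim: h => {a b} [x xA||a b c d _ [p [q [q0 ap bp]]] _ [p' [q' [q0' cp dp]]]
  |a b c d _ [p [q [q0 ap bp]]] _ [p' [q' [q0' cp dp]]]|a b b0 _ [p [q [q0 ap bp]]]].
- have ix : (index x A < #|` A|)%N by rewrite index_mem.
  exists 'X_(Ordinal ix), 1.
  by rewrite !rmorph1 !mulr1 /e1 /e2 /= !mmapX !mmap1U /= nth_index // oner_neq0.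
- by exists 1, 1; rewrite /e1 /e2 !rmorph1 !mulr1 oner_neq0.
- exists (p * q' - p' * q), (q * q'); rewrite !(rmorphM, rmorphB) mulf_neq0 //.
  rewrite -ap -bp -cp -dp; split=> //; ring.
- exists (p * p'), (q * q'); rewrite !(rmorphM, rmorphB) mulf_neq0 //.
  rewrite -ap -bp -cp -dp; split=> //; ring.
- have p0 : e2 p != 0 by rewrite -bp mulf_neq0.
  exists q, p; split=> //; last by rewrite -bp mulKf.
  (* The case [a = 0] is contradictory: [b != 0] makes [p] a nonzero polynomial, which cannot vanish
     on [A]. *)
  rewrite -ap; have [a0|a0] := eqVneq a 0; last by rewrite mulKf.
  have p_neq0 : p != 0 by apply: contraNneq p0 => ->; rewrite rmorph0.
  by have := hA p_neq0; rewrite -/(ev id p) E1 -ap a0 mul0r eqxx.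
Qed.

(** The difference of two values of [a] is a value of 0. The numerator of a fraction for it vanishes
    on [A], so it is the zero polynomial, and the difference is 0. *)
Lemma evaluates_fun a b b' :
  evaluates A w a b -> evaluates A w a b' -> b = b'.
Proof.
move=> ab ab'; apply/eqP; rewrite -subr_eq0; apply/eqP.
have := ev_sub ab ab'; rewrite subrr; move: (b - b') => d d0.
have [p [q [q0 ap bp]]] := ev_fraction d0.
have p0 : p = 0.
  by apply: contra_eq ap => p0; rewrite mul0r eq_sym; apply: hA.
by move: bp; rewrite p0 /ev mmap_zero => /eqP; rewrite mulf_eq0 (negPf q0) orbF => /eqP.
Qed.

(** The same argument with the two fields exchanged: [hw] is the independence of the values. *)
Lemma evaluates_eq0 a :
  (forall p : {mpoly rat[#|` A|]}, p != 0 -> ev w p != 0) ->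
  evaluates A w a 0 -> a = 0.
Proof.
move=> hw a0; have [p [q [q0 ap bp]]] := ev_fraction a0.
have p0 : p = 0.
  by apply: contra_eq bp => p0; rewrite mul0r eq_sym; apply: hw.
have q_neq0 : q != 0 by apply: contraNneq q0 => ->; rewrite /ev mmap_zero.
move: ap; rewrite p0 /ev mmap_zero => /eqP; rewrite mulf_eq0 orbC.
by rewrite (negPf (hA q_neq0)) => /eqP.
Qed.
End Evaluation.

(* A substitute for algebraic independence which is easily transported along a
   mutation: v' on the mutated cluster pulls back to a positive v. *)
Definition freely_evaluated (F : fieldType) (A : {fset F}) : Prop :=
  forall v : F -> rat, {in A, forall x, 0 < v x} ->
  forall a b b', evaluates A v a b -> evaluates A v a b' -> b = b'.

(** * Regular seeds, a weakening of seeds that is stable under mutation *)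

Record regular_seed (F : fieldType) (S : seed F) : Prop := RegularSeed {
  rs_disjoint : [disjoint exch S & frozen S];
  rs_tsss : totally_sign_skew_symmetric (exch S) (exmx S);
  rs_free : freely_evaluated (extended S)
}.

(** The right-hand side of the exchange relation at the values [v]. With [v := id] it is the
    cofactor of [x^-1] in [exchanged S x]. *)
Definition exchange_sum (F K : fieldType) (S : seed F) (x : F) (v : F -> K) : K :=
  \prod_(t <- extended S | (0 < exmx S x t)%R) v t ^+ `|exmx S x t|%N
  + \prod_(t <- extended S | (exmx S x t < 0)%R) v t ^+ `|exmx S x t|%N.

Lemma pchar_rat : [pchar rat] =i pred0.
Proof. exact: pchar_num. Qed.

Lemma is_seed_regular (F : fieldType) (S : seed F) : is_seed S -> regular_seed S.
Proof.
case=> hF hD hI hT; split=> // v _ a b b'.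
exact: (evaluates_fun hF pchar_rat hI).
Qed.

Lemma diag_eq0 (F : fieldType) (A : {fset F}) (B : F -> F -> int) x :
  sign_skew_symmetric A B -> x \in A -> B x x = 0.
Proof.
move=> hB xA; case: (hB x x xA xA) => [[]//|].
by rewrite ltNge -expr2 sqr_ge0.
Qed.

Lemma tsss_sign_skew (F : fieldType) (A : {fset F}) (B : F -> F -> int) :
  totally_sign_skew_symmetric A B -> sign_skew_symmetric A B.
Proof. by move/(_ [::]); apply. Qed.

Lemma in_extended_mutate (F : fieldType) (S : seed F) x y :
  [disjoint exch S & frozen S] -> x \in exch S ->
  (y \in extended (mutate S x)) =
  (y == exchanged S x) || (y != x) && (y \in extended S).
Proof.
move=> hS xS; rewrite /extended /= in_fsetU in_fset1U in_fsetD1 in_fsetU -orbA.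
case: (_ == exchanged S x) => //=; case: (eqVneq y x) => //= ->.
by rewrite (negPf (fdisjointP hS x xS)).
Qed.

Section RegularSeed.
Variables (F : fieldType) (S : seed F).
Hypothesis hS : regular_seed S.

Lemma exch_extended x : x \in exch S -> x \in extended S.
Proof. by move=> xS; rewrite in_fsetU xS. Qed.

Lemma regular_diag x : x \in exch S -> exmx S x x = 0.
Proof. by apply: diag_eq0; apply: tsss_sign_skew; case: hS. Qed.

Lemma eq_exchange_sum (K : fieldType) x (v v' : F -> K) :
  {in extended S, forall t, exmx S x t != 0 -> v t = v' t} ->
  exchange_sum S x v = exchange_sum S x v'.
Proof.
move=> e; rewrite /exchange_sum; congr (_ + _); rewrite big_seq_cond [RHS]big_seq_cond;
by apply: eq_bigr => t /andP[tS bt]; rewrite e // neq_lt bt ?orbT.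
Qed.

Lemma ev_exchange_sum (L : fieldType) (v : F -> L) x :
  evaluates (extended S) v (exchange_sum S x id) (exchange_sum S x v).
Proof.
by rewrite /exchange_sum; apply: ev_add; apply: ev_prod => t tS _;
  apply: ev_exp; apply: ev_var.
Qed.

Lemma ev_exchanged (L : fieldType) (v : F -> L) x :
  x \in exch S -> v x != 0 ->
  evaluates (extended S) v (exchanged S x) ((v x)^-1 * exchange_sum S x v).
Proof.
move=> xS vx; apply: ev_mul; last exact: ev_exchange_sum.
by apply: ev_inv => //; apply: ev_var; apply: exch_extended.
Qed.

Lemma exchanged_notin x : x \in exch S -> exchanged S x \notin extended S.
Proof.
move=> xS; apply/negP => yS; pose v (_ : F) : rat := 1.
have v_gt0 : {in extended S, forall x, 0 < v x} by [].
have := rs_free hS v_gt0 (ev_exchanged xS (oner_neq0 _)) (ev_var v yS).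
rewrite /exchange_sum !big1 ?expr1n // => t _; rewrite expr1n //.
Qed.

Lemma free_mutate x : x \in exch S -> freely_evaluated (extended (mutate S x)).
Proof.
move=> xS v' v'_gt0.
(* The value of [x] is forced by the exchange relation: [x] times its exchanged variable is the
   exchange polynomial. *)
pose v t := if t == x then exchange_sum S x v' / v' (exchanged S x) else v' t.
have x'1 : exchanged S x \in extended (mutate S x).
  by rewrite (in_extended_mutate _ (rs_disjoint hS)) // eqxx.
have v'x'_gt0 : 0 < v' (exchanged S x) by apply: v'_gt0.
have v'_gt0' t : t \in extended S -> t != x -> 0 < v' t.
  move=> tS tx; apply: v'_gt0.
  by rewrite (in_extended_mutate _ (rs_disjoint hS)) // tS tx orbT.
have nz_x t : exmx S x t != 0 -> t != x.
  by apply: contraNneq => ->; rewrite regular_diag.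
(* Since [b_xx = 0], the exchange polynomial does not see the change of value at [x]. *)
have vv' : exchange_sum S x v = exchange_sum S x v'.
  by apply: eq_exchange_sum => t tS /nz_x /negPf tx; rewrite /v tx.
have P_gt0 : 0 < exchange_sum S x v'.
  rewrite /exchange_sum; apply: addr_gt0; rewrite big_seq_cond;
  by apply: prodr_gt0 => t /andP[tS bt]; apply/exprn_gt0/v'_gt0' => //;
     apply: nz_x; rewrite neq_lt bt ?orbT.
have v_gt0 : {in extended S, forall t, 0 < v t}.
  by move=> t tS; rewrite /v; case: eqVneq => tx; [apply: divr_gt0|apply: v'_gt0'].
have vx : v x != 0 by rewrite gt_eqF // v_gt0 // exch_extended.
have sub a b : evaluates (extended (mutate S x)) v' a b -> evaluates (extended S) v a b.
  elim=> {a b} [y||a b c d _ ? _ ?|a b c d _ ? _ ?|a b b0 _ ?]; last 4 first.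
  - exact: ev_one.
  - exact: ev_sub.
  - exact: ev_mul.
  - exact: ev_inv.
  rewrite (in_extended_mutate _ (rs_disjoint hS)) // => /orP[/eqP ->|/andP[yx yS]].
    have -> : v' (exchanged S x) = (v x)^-1 * exchange_sum S x v.
      rewrite vv' /v eqxx invf_div mulfVK // gt_eqF //.
    exact: ev_exchanged.
  have -> : v' y = v y by rewrite /v (negPf yx).
  exact: ev_var.
move=> a b b' /sub ab /sub ab'; exact: rs_free ab ab'.
Qed.

End RegularSeed.

(** Reconciles two labellings: [totally_sign_skew_symmetric] fixes the labels, whereas [mutate]
    renames one. Matrix mutation depends on labels only through their equalities. *)
Lemma mutate_mx_relabel (T U : eqType) (A : {pred T}) (o : T -> U) s
    (B : T -> T -> int) (C : U -> U -> int) :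
  {in A &, injective o} -> {subset s <= A} ->
  {in A &, forall i j, B i j = C (o i) (o j)} ->
  {in A &, forall i j, foldl (fun B k => mutate_mx k B) B s i j =
    foldl (fun C k => mutate_mx k C) C (map o s) (o i) (o j)}.
Proof.
move=> o_inj; elim: s B C => [|k s IH] B C //= sA BC.
apply: IH => [z zs|i j iA jA]; first by apply: sA; rewrite inE zs orbT.
have kA : k \in A by apply: sA; rewrite mem_head.
by rewrite /mutate_mx !(inj_in_eq o_inj) // !BC.
Qed.

Lemma regular_mutate (F : fieldType) (S : seed F) x :
  regular_seed S -> x \in exch S -> regular_seed (mutate S x).
Proof.
move=> hS xS; split; last exact: free_mutate.
- apply/fdisjointP => y /=; rewrite in_fset1U in_fsetD1 => /orP[/eqP ->|/andP[_]].
    by apply: contra (exchanged_notin hS xS) => h; rewrite in_fsetU h orbT.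
  exact: (fdisjointP (rs_disjoint hS)).
- set E := exch _ => s sE; pose o z := if z == exchanged S x then x else z.
  have oE z : z \in E -> o z \in exch S.
    by rewrite /E /o in_fset1U in_fsetD1; case: eqP => //= _ /andP[].
  have o_inj : {in E &, injective o}.
    move=> y z; rewrite /E /o !in_fset1U !in_fsetD1.
    case: (y =P exchanged S x) => [->|_]; case: (z =P exchanged S x) => [->|_] //=.
    - by move=> _ /andP[zx _] e; rewrite -e eqxx in zx.
    - by move=> /andP[yx _] _ e; rewrite e eqxx in yx.
  have H := @mutate_mx_relabel _ _ (mem E) o s (exmx (mutate S x))
    (mutate_mx x (exmx S)) o_inj sE.
  move=> i j iE jE; rewrite !H //.
  (* In the old labels, a mutation sequence of the mutated seed is one that starts with [x]. *)
  apply: (@rs_tsss _ _ hS (x :: map o s)) => //; try exact: oE.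
  by move=> z; rewrite inE => /orP[/eqP -> //|/mapP[y /sE/oE yE ->]].
Qed.

(** For equal signs the two terms agree, for opposite signs they cancel. Evenness lets the Euclidean
    quotient commute with a change of sign. *)
Lemma exchange_term_even (a b : int) : exists k, `|a| * b + a * `|b| = k * 2.
Proof.
have [a0|a0] := leP 0 a; have [b0|b0] := leP 0 b.
- by exists (a * b); rewrite ger0_norm // ger0_norm //; ring.
- by exists 0; rewrite (ger0_norm a0) (ltr0_norm b0); ring.
- by exists 0; rewrite (ltr0_norm a0) (ger0_norm b0); ring.
- by exists (- a * b); rewrite (ltr0_norm a0) (ltr0_norm b0); ring.
Qed.

(** The correction term is zero when [B' i x] is. Otherwise both its factors carry the same sign,
    and reversing both reverses the term. *)
Lemma mutate_mx_sign (T T' : eqType) (B' : T' -> T' -> int) (B : T -> T -> int)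
    (f : T' -> T) (sg : T' -> bool) x i j :
  (f i == f x) = (i == x) -> (f j == f x) = (j == x) ->
  B (f i) (f j) = (-1) ^+ sg i * B' i j ->
  B (f i) (f x) = (-1) ^+ sg i * B' i x ->
  B (f x) (f j) = (-1) ^+ sg x * B' x j ->
  (B' i x != 0 -> sg i = sg x) ->
  mutate_mx (f x) B (f i) (f j) = (-1) ^+ sg i * mutate_mx x B' i j.
Proof.
rewrite /mutate_mx => -> -> -> -> -> sgx; case: ifP => _; first by rewrite mulrN.
have [->|/sgx <-] := eqVneq (B' i x) 0.
  by rewrite mulr0 normr0 !mul0r addr0 div0z !addr0.
case: (sg i); rewrite ?expr0 ?expr1 ?mul1r // !mulN1r !normrN.
have [k e] := exchange_term_even (B' i x) (B' x j).
by rewrite mulrN mulNr -opprD e -mulNr !mulzK // -opprD.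
Qed.

(** * Injective homomorphisms defined on a subset of a field *)

(** The domain is a predicate, so that the same lemmas apply to a given morphism on a cluster
    algebra and to an extension built on a subfield. *)
Record ring_hom_on (F' F : fieldType) (D : F' -> Prop) (f : F' -> F) : Prop :=
  RingHomOn {
  fh_dom1 : D 1;
  fh_domB : forall a b, D a -> D b -> D (a - b);
  fh_domM : forall a b, D a -> D b -> D (a * b);
  fh_1 : f 1 = 1;
  fh_B : forall a b, D a -> D b -> f (a - b) = f a - f b;
  fh_M : forall a b, D a -> D b -> f (a * b) = f a * f b;
  fh_inj : forall a b, D a -> D b -> f a = f b -> a = b
}.

Record field_hom_on (F' F : fieldType) (D : F' -> Prop) (f : F' -> F) : Prop :=
  FieldHomOn {
  fh_ring :> ring_hom_on D f;
  fh_domV : forall a, D a -> D a^-1;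
  fh_V : forall a, D a -> f a^-1 = (f a)^-1
}.

(** [D] consists of the elements that have a value under [w], and [f] chooses the value.
    Independence of [A] makes it unique; independence of the image of [A] makes [f] injective. *)
Lemma field_hom_extension (F' F : fieldType) (A : {fset F'}) (B : {fset F})
    (w : F' -> F) :
  [pchar F'] =i pred0 -> [pchar F] =i pred0 ->
  algebraically_independent A -> algebraically_independent B ->
  {in A &, injective w} -> {in A, forall x, w x \in B} ->
  exists D f, field_hom_on D f /\ {in A, forall x, D x /\ f x = w x}.
Proof.
move=> hF' hF hA hB w_inj wB.
pose D a := exists b, evaluates A w a b.
pose f a := ClassicalEpsilon.epsilon (inhabits 0) (evaluates A w a).
have fE a : D a -> evaluates A w a (f a).
  by move=> Da; apply: ClassicalEpsilon.epsilon_spec.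
have fP a b : evaluates A w a b -> D a /\ f a = b.
  move=> ab; have Da : D a by exists b.
  by split=> //; exact: (evaluates_fun hF' hF hA (fE _ Da) ab).
have w_indep (p : {mpoly rat[#|` A|]}) : p != 0 ->
    mmap ratr (fun i : 'I_#|` A| => w (nth 0 A i)) p != 0.
  move=> p0; apply: (algebraically_independent_family hF hB _ _ p0) => [i j e|i];
    last by apply/wB/mem_nth.
  apply: val_inj; apply/eqP; rewrite -(nth_uniq 0 (ltn_ord i) (ltn_ord j) (fset_uniq A)).
  by apply/eqP; apply: w_inj e; apply: mem_nth.
have ev0 a : evaluates A w a 0 -> a = 0.
  exact: (evaluates_eq0 hF' hF hA w_indep).
(* If [f a = 0], then [a = 0], and both inverses are 0 by convention. *)
have evV a : D a -> evaluates A w a^-1 (f a)^-1.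
  move=> Da; have [fa0|fa0] := eqVneq (f a) 0; last by apply: ev_inv (fE _ Da).
  have := fE _ Da; rewrite fa0 => /ev0 ->; rewrite !invr0; exact: ev_zero.
exists D, f; split; last by move=> x xA; apply: fP; apply: ev_var.
split=> [|a /evV /fP []|a /evV /fP []] //; split.
- by have [] := fP _ _ (ev_one A w).
- by move=> a b /fE ha /fE hb; have [] := fP _ _ (ev_sub ha hb).
- by move=> a b /fE ha /fE hb; have [] := fP _ _ (ev_mul ha hb).
- by have [] := fP _ _ (ev_one A w).
- by move=> a b /fE ha /fE hb; have [] := fP _ _ (ev_sub ha hb).
- by move=> a b /fE ha /fE hb; have [] := fP _ _ (ev_mul ha hb).
- move=> a b /fE ha /fE hb e; apply/eqP; rewrite -subr_eq0; apply/eqP/ev0.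
  by have := ev_sub ha hb; rewrite e subrr.
Qed.

Section RingHomOn.
Variables (F' F : fieldType) (D : F' -> Prop) (f : F' -> F).
Hypothesis hf : ring_hom_on D f.

Lemma fh_dom0 : D 0.
Proof. by rewrite -(subrr 1); apply: (fh_domB hf); apply: (fh_dom1 hf). Qed.

Lemma fh_0 : f 0 = 0.
Proof. by rewrite -(subrr 1) (fh_B hf) ?subrr //; apply: (fh_dom1 hf). Qed.

Lemma fh_domD a b : D a -> D b -> D (a + b).
Proof.
move=> Da Db; rewrite -[b]opprK -(sub0r b).
by apply: (fh_domB hf) => //; apply: (fh_domB hf) => //; apply: fh_dom0.
Qed.

Lemma fh_D a b : D a -> D b -> f (a + b) = f a + f b.
Proof.
move=> Da Db; have DNb : D (0 - b) by apply: (fh_domB hf) => //; apply: fh_dom0.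
rewrite -{1}[b]opprK -(sub0r b) (fh_B hf) // (fh_B hf) ?fh_0 ?sub0r ?opprK //.
exact: fh_dom0.
Qed.

Lemma fh_X a n : D a -> D (a ^+ n) /\ f (a ^+ n) = f a ^+ n.
Proof.
move=> Da; elim: n => [|n [IHD IH]].
  by rewrite !expr0; split; [apply: (fh_dom1 hf)|apply: (fh_1 hf)].
by rewrite !exprS (fh_M hf) // IH; split=> //; apply: (fh_domM hf).
Qed.

Lemma fh_prod (I : eqType) (s : seq I) (P : pred I) (g : I -> F') :
  {in s, forall i, D (g i)} ->
  D (\prod_(i <- s | P i) g i) /\
  f (\prod_(i <- s | P i) g i) = \prod_(i <- s | P i) f (g i).
Proof.
move=> Dg; rewrite 2!(big_seq_cond P).
apply: (big_rec2 (fun a b => D a /\ f a = b)) => [|i b a /andP[si _] [Da <-]].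
  by split; [apply: (fh_dom1 hf)|apply: (fh_1 hf)].
by rewrite (fh_M hf) //; [split=> //; apply: (fh_domM hf) => //|]; apply: Dg.
Qed.

Lemma fh_exchange_sum (S' : seed F') x :
  {in extended S', forall t, D t} ->
  D (exchange_sum S' x id) /\ f (exchange_sum S' x id) = exchange_sum S' x f.
Proof.
move=> DS; rewrite /exchange_sum.
have DX t n : t \in extended S' -> D (t ^+ n) /\ f (t ^+ n) = f t ^+ n.
  by move=> tS; apply: fh_X; exact: DS.
have H (P : pred F') (e : F' -> nat) :
  D (\prod_(t <- extended S' | P t) t ^+ e t) /\
  f (\prod_(t <- extended S' | P t) t ^+ e t) =
  \prod_(t <- extended S' | P t) f t ^+ e t.
  have [|Dp ->] := @fh_prod _ (extended S') P (fun t => t ^+ e t).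
    by move=> t tS; case: (DX t (e t) tS).
  split=> //; rewrite big_seq_cond [RHS]big_seq_cond.
  by apply: eq_bigr => t /andP[tS _]; case: (DX t (e t) tS).
have [Dp fp] := H (fun t => 0 < exmx S' x t) (fun t => `|exmx S' x t|%N).
have [Dn fn] := H (fun t => exmx S' x t < 0) (fun t => `|exmx S' x t|%N).
by split; [apply: fh_domD|rewrite fh_D // fp fn].
Qed.

End RingHomOn.

(** * Coverings of seeds and their stability under mutation *)

Section Covering.
Variables (F' F : fieldType) (D : F' -> Prop) (f : F' -> F).
Hypothesis hf : field_hom_on D f.

(* [sg] records the sign by which a row of S' differs from its image in S. *)
Record covers (sg : F' -> bool) (S' : seed F') (S : seed F) : Prop := Covers {
  cv_regular : regular_seed S;
  cv_disjoint : [disjoint exch S' & frozen S'];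
  cv_dom : {in extended S', forall x, D x};
  cv_extended : {in extended S', forall x, f x \in extended S};
  cv_exch : {in exch S', forall x, f x \in exch S};
  cv_mx : {in exch S' & extended S', forall i j,
    exmx S (f i) (f j) = (-1) ^+ sg i * exmx S' i j};
  cv_sign : {in exch S' &, forall i j, exmx S' i j != 0 -> sg i = sg j};
  cv_out : {in exch S' & extended S, forall i z,
    z \notin f @` extended S' -> exmx S (f i) z = 0}
}.

Section CoveringStep.
Variables (sg : F' -> bool) (S' : seed F') (S : seed F).
Hypothesis hc : covers sg S' S.

Lemma cv_injective : {in extended S' &, injective f}.
Proof. by move=> x y /(cv_dom hc) Dx /(cv_dom hc) Dy; apply: (fh_inj hf). Qed.

(** Variables outside the image do not occur in row [f x], so both monomials can be reindexed along
    [f]. A negative sign of the row swaps them, which leaves the sum unchanged. *)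
Lemma cv_exchange_sum x : x \in exch S' ->
  exchange_sum S (f x) id = exchange_sum S' x f.
Proof.
move=> xS.
(* One statement for both monomials; [P 0 = false] discards the columns outside the image. *)
have prodE (P : pred int) : P 0 = false ->
    \prod_(t <- extended S | P (exmx S (f x) t)) t ^+ `|exmx S (f x) t|%N =
    \prod_(t <- extended S' | P ((-1) ^+ sg x * exmx S' x t))
      f t ^+ `|exmx S' x t|%N.
  move=> P0; rewrite big_mkcond /=.
  rewrite -(@big_fset_incl _ _ _ _ (f @` extended S')) /=; last 2 first.
  - by apply/fsubsetP => _ /imfsetP[t /= tS ->]; apply: (cv_extended hc).
  - by move=> t tS tN; rewrite (cv_out hc) // P0.
  rewrite big_imfset /=; last exact: cv_injective.
  rewrite [RHS]big_mkcond /= big_seq [RHS]big_seq; apply: eq_bigr => t tS.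
  by rewrite (cv_mx hc) // abszMsign.
rewrite /exchange_sum (prodE (fun b => 0 < b)) // (prodE (fun b => b < 0)) //.
case: (sg x); rewrite ?expr0 ?expr1; last first.
  by congr (_ + _); apply: eq_bigl => t; rewrite mul1r.
rewrite addrC; congr (_ + _); apply: eq_bigl => t; rewrite mulN1r.
  by rewrite oppr_lt0.
by rewrite oppr_gt0.
Qed.

Lemma cv_exchanged x : x \in exch S' ->
  D (exchanged S' x) /\ f (exchanged S' x) = exchanged S (f x).
Proof.
move=> xS; have Dx : D x by apply: (cv_dom hc); apply: exch_extended.
have [DP fP] := fh_exchange_sum hf x (cv_dom hc); have DVx := fh_domV hf Dx.
rewrite [exchanged S' x](_ : _ = x^-1 * exchange_sum S' x id) //.
split; first exact: (fh_domM hf).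
by rewrite (fh_M hf) // (fh_V hf) // fP -cv_exchange_sum.
Qed.

Lemma cv_mutate_var x y : x \in exch S' -> y \in extended S' ->
  f (mutate_var S' x y) = mutate_var S (f x) (f y).
Proof.
move=> xS yS; rewrite /mutate_var (inj_in_eq cv_injective yS (exch_extended xS)).
by case: ifP => // _; apply: (cv_exchanged xS).2.
Qed.

(** [covers] contains regularity of [S] only, so freshness is carried back to [S'] along [f]. *)
Lemma cv_exchanged_notin x : x \in exch S' -> exchanged S' x \notin extended S'.
Proof.
move=> xS; apply/negP => /(cv_extended hc); rewrite (cv_exchanged xS).2.
by apply/negP; exact: (exchanged_notin (cv_regular hc) (cv_exch hc xS)).
Qed.
End CoveringStep.
End Covering.

Section CoveringMutation.
Variables (F' F : fieldType) (D : F' -> Prop) (f : F' -> F).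
Hypothesis hf : field_hom_on D f.

(** The exchanged variable inherits the sign of [x]. Matrix conditions are checked in the old
    labels, to which [o] returns. *)
Lemma covers_mutate sg S' S x :
  covers D f sg S' S -> x \in exch S' ->
  covers D f (fun z => sg (if z == exchanged S' x then x else z))
    (mutate S' x) (mutate S (f x)).
Proof.
move=> hc xS; have hS := cv_regular hc; have fxS := cv_exch hc xS.
have [Dx' fx'] := cv_exchanged hf hc xS.
have x'N := cv_exchanged_notin hf hc xS.
have ext' z := in_extended_mutate z (cv_disjoint hc) xS.
have ext z := in_extended_mutate z (rs_disjoint hS) fxS.
pose o z := if z == exchanged S' x then x else z.
have xE := exch_extended xS.
have oext z : z \in extended (mutate S' x) -> o z \in extended S'.
  by rewrite ext' /o; case: eqP => [_ _|_ /andP[]].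
have oexch z : z \in exch (mutate S' x) -> o z \in exch S'.
  by rewrite /= in_fset1U in_fsetD1 /o; case: eqP => [_ _|_ /andP[]].
have f_inj := inj_in_eq (cv_injective hf hc).
have dom' : {in extended (mutate S' x), forall z, D z}.
  by move=> z; rewrite ext' => /orP[/eqP -> //|/andP[_ /(cv_dom hc)]].
have fo z : z \in extended (mutate S' x) ->
    (if f z == exchanged S (f x) then f x else f z) = f (o z).
  move=> zE; rewrite -fx' /o.
  have -> : (f z == f (exchanged S' x)) = (z == exchanged S' x).
    by apply/eqP/eqP => [|-> //]; apply: (fh_inj hf) => //; apply: dom'.
  by case: ifP.
have subE z : z \in exch (mutate S' x) -> z \in extended (mutate S' x).
  exact: exch_extended.
split.
- exact: regular_mutate.
- apply/fdisjointP => z; rewrite /= in_fset1U in_fsetD1 => /orP[/eqP ->|/andP[_]].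
    by apply: contra x'N => h; rewrite in_fsetU h orbT.
  exact: (fdisjointP (cv_disjoint hc)).
- exact: dom'.
- move=> z; rewrite ext' ext => /orP[/eqP ->|/andP[zx zE]].
    by rewrite fx' eqxx.
  by rewrite f_inj // zx (cv_extended hc) // orbT.
- move=> z; rewrite /= !in_fset1U !in_fsetD1 => /orP[/eqP ->|/andP[zx zE]].
    by rewrite fx' eqxx.
  by rewrite f_inj ?exch_extended // zx (cv_exch hc) // orbT.
- move=> i j iE jE /=; rewrite (fo _ (subE _ iE)) (fo _ jE) -/(o i) -/(o j).
  have oi := oexch _ iE; have oj := oext _ jE; have oiE := exch_extended oi.
  apply: mutate_mx_sign; rewrite ?f_inj ?(cv_mx hc) //.
  exact: (cv_sign hc).
(* A nonzero new entry comes from an old entry at the same place or from a path through [x]; either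
   way the signs agree. *)
- move=> i j iE jE /=; rewrite -/(o i) -/(o j) /mutate_mx.
  have oi := oexch _ iE; have oj := oexch _ jE.
  case: ifP => [_|_]; first by rewrite oppr_eq0; exact: (cv_sign hc).
  have [ij0|ij _] := eqVneq (exmx S' (o i) (o j)) 0; last exact: (cv_sign hc).
  have [ix0|ix] := eqVneq (exmx S' (o i) x) 0; first by rewrite ij0 ix0 normr0 !mul0r.
  have [xj0|xj] := eqVneq (exmx S' x (o j)) 0; first by rewrite ij0 xj0 normr0 !mulr0.
  by move=> _; rewrite (cv_sign hc oi xS ix) (cv_sign hc xS oj xj).
(* The image loses only [f x], and [z] differs from it. So [z] was already outside the image, and
   the rows of [i] and [x] vanish there. *)
- move=> i z iE zE zN /=; rewrite (fo _ (subE _ iE)).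
  have zx' : z != exchanged S (f x).
    apply: contraNneq zN => ->; rewrite -fx'; apply: in_imfset => /=.
    by rewrite ext' eqxx.
  move: zE; rewrite ext (negPf zx') /= => /andP[zx zE].
  have zN' : z \notin f @` extended S'.
    apply: contra zN => /imfsetP[y /= yE zy]; rewrite zy; apply: in_imfset => /=.
    rewrite ext' yE andbT orbC; case: eqP => // yx.
    by rewrite zy yx eqxx in zx.
  have oi := oexch _ iE.
  rewrite /mutate_mx (negPf zx) !(cv_out hc _ zE zN') // normr0 !mulr0.
  by rewrite oppr0 if_same.
Qed.

Lemma covers_admissible s sg S' S : covers D f sg S' S -> admissible S' s ->
  [/\ admissible S (map f s),
      exists sg1, covers D f sg1 (mutate_seq S' s) (mutate_seq S (map f s))
    & {in extended S', forall y,
        f (mutate_var_seq S' s y) = mutate_var_seq S (map f s) (f y)}].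
Proof.
elim: s sg S' S => [|x s IH] sg S' S hc /=.
  by move=> _; split=> //; exists sg.
case/andP=> xS sS; have [adm [sg1 hc1] var] := IH _ _ _ (covers_mutate hc xS) sS.
split.
- by rewrite (cv_exch hc).
- by exists sg1.
move=> y yS; rewrite -(cv_mutate_var hf hc) // var //.
rewrite (in_extended_mutate _ (cv_disjoint hc)) // /mutate_var.
by case: (eqVneq y x) => [_|yx] /=; rewrite ?eqxx // yx yS orbT.
Qed.

(** A covering persists along admissible sequences, so all cluster variables, and with them the
    whole algebra, lie in [D]. *)
Lemma covers_rcm sg S' S : covers D f sg S' S ->
  rooted_cluster_morphism S' S f /\ injective_on_algebra S' f.
Proof.
move=> hc.
have dom a : cluster_algebra S' a -> D a.
  elim=> {a} [|x xS|x [s [adm xs]]|a b _ ? _ ?|a b _ ? _ ?].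
  - exact: (fh_dom1 hf).
  - by apply: (cv_dom hc); rewrite in_fsetU xS orbT.
  - have [_ [sg1 hc1] _] := covers_admissible hc adm.
    by apply: (cv_dom hc1); apply: exch_extended.
  - exact: (fh_domB hf).
  - exact: (fh_domM hf).
split; last by move=> a b /dom Da /dom Db; exact: (fh_inj hf).
split.
- move=> a; elim=> {a} [|x xS|x [s [adm xs]]|a b ha ? hb ?|a b ha ? hb ?].
  - by rewrite (fh_1 hf); exact: ca_one.
  - have : f x \in extended S by apply: (cv_extended hc); rewrite in_fsetU xS orbT.
    (* A frozen variable may be sent to an exchangeable one, which is a cluster variable for the
       empty sequence. *)
    rewrite in_fsetU => /orP[fxS|]; last exact: ca_frozen.
    by apply: ca_cluster; exists [::].
  - have [adm1 [sg1 hc1] _] := covers_admissible hc adm.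
    by apply: ca_cluster; exists (map f s); split=> //; apply: (cv_exch hc1).
  - by rewrite (fh_B hf); [exact: ca_sub|exact: dom|exact: dom].
  - by rewrite (fh_M hf); [exact: ca_mul|exact: dom|exact: dom].
- exact: (fh_1 hf).
- by move=> a b /dom Da /dom Db; apply: (fh_D hf).
- by move=> a b /dom Da /dom Db; apply: (fh_M hf).
- by move=> x xS; left; apply: (cv_extended hc).
- by move=> x xS; left; apply: (cv_exch hc).
- move=> s y /andP[adm _] yS; have [_ _] := covers_admissible hc adm; exact.
Qed.
End CoveringMutation.

(** * Seed embeddings and sub-seeds *)

(** The combinatorial form to which both injective rooted cluster morphisms and isomorphisms onto
    sub-seeds with a vanishing block reduce. *)
Record seed_embedding (F' F : fieldType) (S' : seed F') (S : seed F) (f : F' -> F)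
    : Prop := SeedEmbedding {
  se_hom : seed_hom S' S f;
  se_inj : {in extended S' &, injective f};
  se_abs : {in exch S' & extended S', forall x y,
    `|exmx S' x y| = `|exmx S (f x) (f y)|};
  se_out : {in exch S' & extended S, forall x z,
    z \notin f @` extended S' -> exmx S (f x) z = 0}
}.

Lemma eq_abs_sign (a b : int) : `|b| = `|a| ->
  (0 <= a * b -> a = b) /\ (a * b <= 0 -> a = - b).
Proof.
move=> /eqP; rewrite eqr_norm2 => /orP[] /eqP ->; split=> //.
- move=> h; have : a * a = 0 by apply/eqP; rewrite eq_le h -expr2 sqr_ge0.
  by move/eqP; rewrite mulf_eq0 orbb => /eqP ->; rewrite oppr0.
- rewrite mulrN oppr_ge0 => h.
  have : a * a = 0 by apply/eqP; rewrite eq_le h -expr2 sqr_ge0.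
  by move/eqP; rewrite mulf_eq0 orbb => /eqP ->; rewrite oppr0.
- by rewrite opprK.
Qed.

Lemma seed_embedding_rcm (F' F : fieldType) (S' : seed F') (S : seed F) (w : F' -> F) :
  is_seed S' -> is_seed S -> seed_embedding S' S w ->
  exists f, [/\ rooted_cluster_morphism S' S f, injective_on_algebra S' f
              & {in extended S', f =1 w}].
Proof.
move=> hS' hS [hw w_inj w_abs w_out].
have [|D [f [hf wf]]] := field_hom_extension (seed_char0 hS') (seed_char0 hS)
  (seed_indep hS') (seed_indep hS) w_inj; first exact: sh_extended hw.
have fw x : x \in extended S' -> f x = w x by move=> /wf [].
(* One reversed entry makes the row negative; as [x] is adjacent to itself, all nonzero entries of
   the row are then reversed. *)
pose sg x := has (fun y => exmx S (w x) (w y) * exmx S' x y < 0) (extended S').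
have mxE : {in exch S' & extended S', forall i j,
    exmx S (w i) (w j) = (-1) ^+ sg i * exmx S' i j}.
  move=> i j iS jS; have [pos neg] := eq_abs_sign (w_abs _ _ iS jS).
  case sgi: (sg i); rewrite ?expr0 ?expr1 ?mulN1r ?mul1r.
    have /hasP[y yS yneg] := sgi; apply: neg.
    have := sh_sign hw iS jS iS yS (or_intror erefl).
    by rewrite (nmulr_lge0 _ yneg).
  by apply: pos; rewrite leNgt; apply: contraFN sgi => h; apply/hasP; exists j.
suff hc : covers D f sg S' S.
  by have [rcm inj] := covers_rcm hf hc; exists f; split.
have eS' x : x \in exch S' -> x \in extended S' by exact: exch_extended.
have img : f @` extended S' = w @` extended S' by apply: eq_in_imfset.
split.
- exact: is_seed_regular.
- exact: seed_disjoint.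
- by move=> x /wf [].
- by move=> x xS; rewrite fw //; apply: (sh_extended hw).
- by move=> x xS; rewrite fw ?eS' //; apply: (sh_exch hw).
- by move=> i j iS jS; rewrite (fw _ (eS' _ iS)) (fw _ jS) mxE.
- move=> i j iS jS ij.
  have ji : exmx S' j i != 0.
    have [[/eqP]|] := tsss_sign_skew (seed_tsss hS') iS jS; first by rewrite (negPf ij).
    by move=> h; apply: contraTneq h => ->; rewrite mulr0.
  (* If the signs of [i] and [j] differed, this product would be [-b^2 c^2] with [b] and [c]
     nonzero. *)
  have := sh_sign hw iS (eS' _ jS) jS (eS' _ iS) (or_introl (elimN eqP ij)).
  rewrite !mxE ?eS' //.
  move: ij ji; set b := exmx S' i j; set c := exmx S' j i => b0 c0.
  have p : 0 < b ^+ 2 * c ^+ 2 by rewrite mulr_gt0 // exprn_even_gt0.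
  have neg d : d = - (b ^+ 2 * c ^+ 2) -> (0 <= d) = false.
    by move=> ->; rewrite oppr_ge0 leNgt p.
  by case: (sg i); case: (sg j) => //; rewrite neg //; ring.
- by move=> i z iS zS; rewrite img fw ?eS' //; apply: w_out.
Qed.

Lemma extended_sub_seed (F : fieldType) (S : seed F) (I0 I1 : {fset F}) :
  I0 `<=` exch S -> extended (sub_seed S I0 I1) = extended S `\` I1.
Proof.
move=> /fsubsetP h; apply/fsetP => z; rewrite /extended /= !inE.
case: (z \in I1); rewrite ?andbF ?orbT //= orbF.
have := h z; case: (z \in I0); case: (z \in exch S); case: (z \in frozen S) => //;
by move/(_ isT).
Qed.

Lemma exch_sub_seed (F : fieldType) (S : seed F) (I' I1 : {fset F}) :
  I' `<=` exch S ->
  exch (sub_seed S (exch S `\` (I' `|` I1)) I1) = I' `\` I1.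
Proof.
move=> /fsubsetP h; apply/fsetP => z; rewrite /= !inE.
have := h z; case: (z \in I'); case: (z \in I1); case: (z \in exch S) => //.
by move/(_ isT).
Qed.

Lemma seed_iso_embedding (F' F : fieldType) (S' : seed F') (S : seed F)
    (I' I1 : {fset F}) (f : F' -> F) :
  I' `<=` exch S -> I1 `<=` extended S ->
  {in I' & I1, forall x y, diag_unitization S x y = 0} ->
  seed_iso S' (sub_seed S (exch S `\` (I' `|` I1)) I1) f ->
  seed_embedding S' S f.
Proof.
move=> I'S I1S zero [[fE fX sgn abs] f_inj extE exE absE].
have extT := extended_sub_seed I1 (fsubsetDl (exch S) (I' `|` I1)).
split=> //.
  split=> //.
    by move=> x /fE; rewrite extT in_fsetD => /andP[].
  by move=> x /fX; rewrite /= in_fsetD => /andP[].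
move=> x z xS zS; rewrite extE extT in_fsetD zS andbT negbK => zI1.
(* Exchangeable variables of the sub-seed avoid [I1], so the entry at [(f x, z)] is off the
   diagonal, where the unitization agrees with the matrix. *)
have := fX _ xS; rewrite (exch_sub_seed _ I'S) in_fsetD => /andP[fxI1 fxI'].
have := zero _ _ fxI' zI1; rewrite /diag_unitization.
by case: eqP => // e; rewrite e zI1 in fxI1.
Qed.

(** The resulting [I0] consists of the exchangeable variables of [S] that are images of frozen
    variables of [S']. *)
Lemma embedding_seed_iso (F' F : fieldType) (S' : seed F') (S : seed F) (f : F' -> F) :
  seed_embedding S' S f ->
  let I' := f @` exch S' in let I1 := extended S `\` f @` extended S' in
  [/\ I' `<=` exch S, I1 `<=` extended S,
      {in I' & I1, forall x y, diag_unitization S x y = 0}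
    & seed_iso S' (sub_seed S (exch S `\` (I' `|` I1)) I1) f].
Proof.
move=> [[fE fX sgn abs] f_inj absE out] I' I1.
have I'S : I' `<=` exch S by apply/fsubsetP => _ /imfsetP[x /= xS ->]; apply: fX.
have I1S : I1 `<=` extended S by exact: fsubsetDl.
have I'I1 x : x \in exch S' -> f x \notin I1.
  move=> xS; rewrite in_fsetD in_imfset //=; exact: exch_extended.
have extT : extended (sub_seed S (exch S `\` (I' `|` I1)) I1) = f @` extended S'.
  rewrite (extended_sub_seed _ (fsubsetDl _ _)); apply/fsetP => z.
  rewrite !in_fsetD negb_and negbK andb_orl andNb orbF.
  case: imfsetP => //= -[x /= xS ->]; exact: fE.
have exT : exch (sub_seed S (exch S `\` (I' `|` I1)) I1) = I'.
  rewrite (exch_sub_seed _ I'S); apply/fsetP => z; rewrite in_fsetD.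
  by rewrite andbC; case: imfsetP => //= -[x /= xS ->]; exact: I'I1.
split=> //.
  move=> _ z /imfsetP[x /= xS ->] zI1; rewrite /diag_unitization.
  case: eqP => [e|_]; first by rewrite -e (negPf (I'I1 _ xS)) in zI1.
  by move: zI1; rewrite in_fsetD => /andP[zN zS]; apply: out.
split=> //; split=> //.
  by move=> x xS; rewrite extT in_imfset.
by move=> x xS; rewrite exT in_imfset.
Qed.

(** Total sign-skew-symmetry fixes the labels and [exmx] is unchanged, so a mutation sequence of the
    sub-seed is one of [S] seen on fewer rows and columns. *)
Lemma sub_seed_is_seed (F : fieldType) (S : seed F) (I0 I1 : {fset F}) :
  is_seed S -> I0 `<=` exch S -> is_seed (sub_seed S I0 I1).
Proof.
move=> hS I0S; split.
- exact: seed_char0 hS.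
- apply/fdisjointP => z; rewrite /= !inE negb_or => /andP[/andP[z0 z1] zS].
  by rewrite (negPf z0) (negPf z1) (negPf (fdisjointP (seed_disjoint hS) _ zS)).
- have sub : {subset extended (sub_seed S I0 I1) <= extended S}.
    by move=> z; rewrite extended_sub_seed // in_fsetD => /andP[].
  move=> p p0; apply: (algebraically_independent_family (seed_char0 hS)
    (seed_indep hS) _ _ p0) => [i j e|i].
    apply: val_inj; apply/eqP; rewrite -(nth_uniq 0 (ltn_ord i) (ltn_ord j) (fset_uniq _)).
    exact/eqP.
  by apply/sub/mem_nth.
- have sub : {subset exch (sub_seed S I0 I1) <= exch S}.
    by move=> z; rewrite /= in_fsetD => /andP[].
  move=> s ss i j /sub iS /sub jS; apply: (seed_tsss hS) => // z /ss; exact: sub.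
Qed.

(** * Reading matrix entries off values of exchange polynomials *)

Section TestValues.
Variables (F : fieldType) (S : seed F).

Definition two_at (u t : F) : rat := 2 ^+ (t == u).

(** The positive part of [b]; [posn (- b)] is the exponent in the second monomial. *)
Definition posn (b : int) : nat := if 0 < b then `|b|%N else 0.

Lemma two_at_gt0 u t : 0 < two_at u t.
Proof. by rewrite exprn_gt0. Qed.

Lemma prod_two_at (P : pred F) (e : F -> nat) (u : F) : u \in extended S ->
  \prod_(t <- extended S | P t) two_at u t ^+ e t = 2 ^+ (if P u then e u else 0).
Proof.
move=> uS; rewrite big_mkcond (bigD1_seq u) ?fset_uniq //= big1 => [|t tu].
  by rewrite /two_at eqxx mulr1; case: ifP.
by rewrite /two_at (negPf tu) expr1n if_same.
Qed.

Lemma exchange_sum_two_at x u : u \in extended S ->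
  exchange_sum S x (two_at u)
  = 2 ^+ posn (exmx S x u) + 2 ^+ posn (- exmx S x u).
Proof. by move=> uS; rewrite /exchange_sum !prod_two_at // /posn oppr_gt0 abszN. Qed.

(** The product of two test points also covers [u = z], where the coordinate is 4. *)
Lemma exchange_sum_two_at2 x u z : u \in extended S -> z \in extended S ->
  exchange_sum S x (fun t => two_at u t * two_at z t)
  = 2 ^+ (posn (exmx S x u) + posn (exmx S x z))
    + 2 ^+ (posn (- exmx S x u) + posn (- exmx S x z)).
Proof.
move=> uS zS; rewrite !exprD /exchange_sum.
under eq_bigr do rewrite exprMn; under [X in _ + X]eq_bigr do rewrite exprMn.
by rewrite !big_split /= !prod_two_at // /posn !oppr_gt0 !abszN.
Qed.
End TestValues.

Lemma posn_sum (b : int) : 2 ^+ posn b + 2 ^+ posn (- b) = 1 + 2 ^+ `|b|%N :> rat.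
Proof.
rewrite /posn oppr_gt0 abszN; case: (ltgtP b 0) => [_|_|->] //=.
by rewrite expr0 addrC.
Qed.

(** Entries of equal sign contribute to the same monomial, entries of opposite signs to different
    ones. *)
Lemma posn_sum2 (b c : int) : b != 0 -> c != 0 ->
  2 ^+ (posn b + posn c) + 2 ^+ (posn (- b) + posn (- c)) =
  (if 0 < b * c then 1 + 2 ^+ (`|b| + `|c|) else 2 ^+ `|b|%N + 2 ^+ `|c|%N) :> rat.
Proof.
rewrite /posn !oppr_gt0 !abszN.
case: (ltgtP b 0) => [b0|b0|//]; case: (ltgtP c 0) => [c0|c0|//] _ _.
- by rewrite nmulr_rgt0 // c0 expr0.
- by rewrite nmulr_rgt0 // ltNge ltW //= addn0 addrC.
- by rewrite pmulr_rgt0 // ltNge ltW //= addn0.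
- by rewrite pmulr_rgt0 // c0 expr0 addrC.
Qed.

(** The difference factors as [(2^m - 1)(2^n - 1)]. This separates the two outcomes of
    [posn_sum2]. *)
Lemma expr2_sum_neq (m n : nat) : (0 < m)%N -> (0 < n)%N ->
  1 + 2 ^+ (m + n) != 2 ^+ m + 2 ^+ n :> rat.
Proof.
move=> m0 n0; rewrite -subr_eq0 exprD.
rewrite (_ : _ - _ = (2 ^+ m - 1) * (2 ^+ n - 1)); last by ring.
by rewrite mulf_neq0 // subr_eq0 gt_eqF // exprn_egt1 // -lt0n.
Qed.

Lemma posn_sum_abs (a b : int) :
  2 ^+ posn a + 2 ^+ posn (- a) = 2 ^+ posn b + 2 ^+ posn (- b) :> rat ->
  `|a| = `|b|.
Proof.
by rewrite !posn_sum => /addrI /ieexprIn e; rewrite -!abszE e.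
Qed.

Lemma posn_sum2_sign (a b a' b' : int) : `|a'| = `|a| -> `|b'| = `|b| ->
  2 ^+ (posn a + posn b) + 2 ^+ (posn (- a) + posn (- b)) =
  2 ^+ (posn a' + posn b') + 2 ^+ (posn (- a') + posn (- b')) :> rat ->
  0 <= (a' * a) * (b' * b).
Proof.
move=> ea eb; have [->|a0] := eqVneq a 0; first by rewrite mulr0 mul0r.
have [->|b0] := eqVneq b 0; first by rewrite !mulr0.
have a'0 : a' != 0 by rewrite -normr_eq0 ea normr_eq0.
have b'0 : b' != 0 by rewrite -normr_eq0 eb normr_eq0.
have na : `|a'|%N = `|a|%N by apply/eqP; rewrite -eqz_nat !abszE ea.
have nb : `|b'|%N = `|b|%N by apply/eqP; rewrite -eqz_nat !abszE eb.
rewrite !posn_sum2 // na nb mulrACA.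
have neq := expr2_sum_neq (_ : 0 < `|a|)%N (_ : 0 < `|b|)%N.
case: (ltgtP 0 (a * b)) => [ab|ab|/esym/eqP];
  last by rewrite mulf_eq0 (negPf a0) (negPf b0).
  case: (ltgtP 0 (a' * b')) => [ab' _|ab' e|<- _]; last by rewrite mul0r.
    by rewrite mulr_ge0 // ltW.
  by move/eqP: e; rewrite (negPf (neq _ _)) ?absz_gt0.
case: (ltgtP 0 (a' * b')) => [ab' e|ab' _|<- _]; last by rewrite mul0r.
  by move/esym/eqP: e; rewrite (negPf (neq _ _)) ?absz_gt0.
by rewrite mulr_le0 // ltW.
Qed.

(** An integer has the same value at every point, whereas a variable takes the values 1 and 2 at two
    constant points. *)
Lemma variable_not_int (F : fieldType) (S : seed F) x :
  regular_seed S -> x \in extended S -> ~ is_integer x.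
Proof.
move=> hS xS [n xn].
have vx (v : F -> rat) : (forall t, 0 < v t) -> v x = n%:~R.
  move=> v0; apply: (rs_free hS (v := v)); first by move=> t _; apply: v0.
    exact: ev_var.
  by rewrite xn; apply: ev_int.
have := vx (fun=> 1) (fun=> ltr01); rewrite -(vx (fun=> 2) (fun=> ltr0n _ 2)).
by [].
Qed.

(** * From injective rooted cluster morphisms to seed embeddings *)

Section MorphismToEmbedding.
Variables (F' F : fieldType) (S' : seed F') (S : seed F) (f : F' -> F).
Hypotheses (hS' : regular_seed S') (hS : regular_seed S).
Hypotheses (hf : rooted_cluster_morphism S' S f) (f_inj : injective_on_algebra S' f).

Lemma rcm_ring_hom : ring_hom_on (cluster_algebra S') f.
Proof.
split; [exact: ca_one|exact: ca_sub|exact: ca_mul|exact: rcm_one hf|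
  |exact: rcm_mul hf|exact: f_inj].
move=> a b ha hb; apply/eqP; rewrite eq_sym subr_eq -(rcm_add hf) ?subrK //.
exact: ca_sub.
Qed.

Lemma cluster_algebra_variable x : x \in extended S' -> cluster_algebra S' x.
Proof.
rewrite in_fsetU => /orP[xS|]; last exact: ca_frozen.
by apply: ca_cluster; exists [::].
Qed.

Lemma rcm_int (n : int) : cluster_algebra S' n%:~R /\ f n%:~R = n%:~R.
Proof.
have hr := rcm_ring_hom.
have nat_case (m : nat) : cluster_algebra S' m%:R /\ f m%:R = m%:R.
  elim: m => [|m [Dm fm]]; first by split; [apply: fh_dom0 hr|apply: fh_0 hr].
  rewrite -!natr1 (fh_D hr) // ?fm ?(fh_1 hr) //; last exact: ca_one.
  by split=> //; exact: (fh_domD hr Dm (ca_one _)).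
case: n => m; first exact: nat_case.
have [Dm fm] := nat_case m.+1; rewrite NegzE !mulrNz -!pmulrn.
rewrite -(sub0r (m.+1%:R)) -[- _ in RHS]sub0r (fh_B hr) ?(fh_0 hr) ?fm //;
  last exact: fh_dom0 hr.
by split=> //; apply: ca_sub => //; exact: fh_dom0 hr.
Qed.

(** [f] fixes the integers, so by injectivity an integer image would make [x] an integer. This
    removes the integer alternative from (CM1) and (CM2). *)
Lemma not_integer_image x : x \in extended S' -> ~ is_integer (f x).
Proof.
move=> xS [n fx]; apply: (variable_not_int hS' xS); exists n.
have [Dn fn] := rcm_int n.
by apply: f_inj => //; [apply: cluster_algebra_variable|rewrite fn].
Qed.

Lemma rcm_extended x : x \in extended S' -> f x \in extended S.
Proof. by move=> xS; case: (rcm_CM1 hf xS) => // /(not_integer_image xS). Qed.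

Lemma rcm_exch x : x \in exch S' -> f x \in exch S.
Proof.
by move=> xS; case: (rcm_CM2 hf xS) => // /(not_integer_image (exch_extended xS)).
Qed.

Lemma rcm_injective : {in extended S' &, injective f}.
Proof.
by move=> x y /cluster_algebra_variable Dx /cluster_algebra_variable Dy; apply: f_inj.
Qed.

Lemma variable_neq0 (E : fieldType) (T : seed E) x :
  regular_seed T -> x \in extended T -> x != 0.
Proof. by move=> hT xT; apply/eqP => x0; apply: (variable_not_int hT xT); exists 0. Qed.

(** (CM3) for the sequence [[:: x]] sends the exchanged variable of [x] to that of [f x];
    multiplying by [f x] clears the denominator. *)
Lemma rcm_exchange_sum x : x \in exch S' ->
  exchange_sum S (f x) id = exchange_sum S' x f.
Proof.
move=> xS; have fxS := rcm_exch xS; have xE := exch_extended xS.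
have Dx := cluster_algebra_variable xE.
have Dx' : cluster_algebra S' (exchanged S' x).
  by apply: ca_cluster; exists [:: x]; rewrite /= xS in_fset1U eqxx.
have fx' : f (exchanged S' x) = exchanged S (f x).
  have := rcm_CM3 hf (s := [:: x]) (y := x); rewrite /= /mutate_var !eqxx.
  by apply=> //; rewrite /biadmissible /= xS fxS.
have e (E : fieldType) (T : seed E) y : regular_seed T -> y \in exch T ->
    exchange_sum T y id = y * exchanged T y.
  by move=> hT yT; rewrite mulVKf // (variable_neq0 hT) ?exch_extended.
have [_ <-] := fh_exchange_sum rcm_ring_hom x cluster_algebra_variable.
by rewrite !e // (rcm_mul hf) // fx'.
Qed.

(** Both sides are values at [v] of the same element of [F], and regularity of [S] makes values
    unique. *)
Lemma rcm_exchange_value x (v : F -> rat) : x \in exch S' -> (forall t, 0 < v t) ->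
  exchange_sum S (f x) v = exchange_sum S' x (v \o f).
Proof.
move=> xS v0; have v0' : {in extended S, forall t, 0 < v t} by move=> t _.
apply: (rs_free hS v0'); first exact: ev_exchange_sum.
rewrite rcm_exchange_sum //.
by rewrite /exchange_sum; apply: ev_add; apply: ev_prod => t tS _; apply: ev_exp;
  apply: ev_var; apply: rcm_extended.
Qed.

Lemma two_at_image y : y \in extended S' ->
  {in extended S', two_at (f y) \o f =1 two_at y}.
Proof. by move=> yS t tS; rewrite /two_at /= (inj_in_eq rcm_injective). Qed.

Lemma rcm_abs : {in exch S' & extended S', forall x y,
  `|exmx S' x y| = `|exmx S (f x) (f y)|}.
Proof.
move=> x y xS yS; apply/esym/posn_sum_abs.
rewrite -(exchange_sum_two_at _ yS) -exchange_sum_two_at ?rcm_extended //.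
rewrite rcm_exchange_value //; last exact: two_at_gt0.
by apply: eq_exchange_sum => t tS _; apply: two_at_image.
Qed.

Lemma rcm_row_sign x y w :
  x \in exch S' -> y \in extended S' -> w \in extended S' ->
  0 <= (exmx S (f x) (f y) * exmx S' x y) * (exmx S (f x) (f w) * exmx S' x w).
Proof.
move=> xS yS wS; apply: posn_sum2_sign; rewrite -?rcm_abs //.
rewrite -(exchange_sum_two_at2 _ yS wS) -exchange_sum_two_at2 ?rcm_extended //.
rewrite rcm_exchange_value // => [|t]; last by rewrite mulr_gt0 ?two_at_gt0.
by apply: eq_exchange_sum => t tS _; rewrite /= -!two_at_image.
Qed.

Lemma rcm_seed_embedding : seed_embedding S' S f.
Proof.
split; [|exact: rcm_injective|exact: rcm_abs|].
  split; [exact: rcm_extended|exact: rcm_exch| |by move=> x y xS yS; rewrite rcm_abs].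
  move=> x y z w xS yS zS wS [xz|<-]; last exact: rcm_row_sign.
  have [xE zE] := (exch_extended xS, exch_extended zS).
  (* Different rows are compared through the mutual entries [(x, z)] and [(z, x)]. *)
  have h1 := rcm_row_sign xS yS zE; have h2 := rcm_row_sign zS xE wS.
  set a := exmx S (f x) (f y) * _ in h1 *; set b := exmx S (f z) (f w) * _ in h2 *.
  (* In each seed the two mutual entries have opposite signs, so the product of all four is
     positive. *)
  have h3 : 0 < (exmx S (f x) (f z) * exmx S' x z) * (exmx S (f z) (f x) * exmx S' z x).
    rewrite mulrACA; have xz0 : exmx S' x z <> 0 by [].
    have [[//]|neg'] := tsss_sign_skew (rs_tsss hS') xS zS.
    have fxz0 : exmx S (f x) (f z) <> 0.
      by move/eqP; rewrite -normr_eq0 -rcm_abs // normr_eq0 => /eqP.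
    have [[//]|neg] := tsss_sign_skew (rs_tsss hS) (rcm_exch xS) (rcm_exch zS).
    by rewrite nmulr_rgt0.
  move: h1 h2 h3; set c := _ * exmx S' x z; set d := _ * exmx S' z x => h1 h2 h3.
  rewrite -(pmulr_lge0 _ h3).
  have -> : a * b * (c * d) = (a * c) * (d * b) by ring.
  exact: mulr_ge0.
(* Pulled back to [S'], the point with value 2 at [z] is the all-ones point, where the sum is 2; so
   the entry at [z] is 0. *)
move=> x z xS zS zN.
have : `|exmx S (f x) z| = `|0 : int|.
  apply: posn_sum_abs; rewrite -(exchange_sum_two_at _ zS).
  rewrite rcm_exchange_value //; last exact: two_at_gt0.
  rewrite (eq_exchange_sum (v' := fun=> 1)) => [|t tS _]; last first.
    rewrite /= /two_at; case: eqP => // e.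
    by rewrite -e in_imfset in zN.
  rewrite /exchange_sum !big1 // => t _; exact: expr1n.
by move/eqP; rewrite normr0 normr_eq0 => /eqP.
Qed.
End MorphismToEmbedding.

(** * Characterization of proper subalgebras, and the trivial ones *)

Lemma seed_iso_card (F' F : fieldType) (S' : seed F') (S : seed F) f :
  seed_iso S' S f -> #|` extended S'| = #|` extended S|.
Proof.
move=> hf; rewrite -(si_extended hf); apply/esym.
by apply: card_in_imfset; exact: (si_inj hf).
Qed.

Lemma seed_iso_trivial (F' F : fieldType) (S' : seed F') (S : seed F) f :
  seed_iso S' S f -> trivial S' <-> trivial S.
Proof.
move=> hf; rewrite /trivial -(si_exch hf); split=> [->|h]; first exact: imfset0.
apply/eqP/fset0Pn => -[x xS].
by have : f x \in f @` exch S' by [exact: in_imfset]; rewrite h.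
Qed.

Lemma seed_iso_trivial_rci (F' F : fieldType) (S' : seed F') (S : seed F) f :
  is_seed S' -> is_seed S -> seed_iso S' S f -> trivial S' ->
  rooted_cluster_isomorphic S' S.
Proof.
move=> hS' hS hf trS'; have trS := (seed_iso_trivial hf).1 trS'.
have hemb : seed_embedding S' S f.
  case: (hf) => hom inj extE _ abs; split=> // x z _ zS.
  by rewrite extE zS.
have [g [rcm inj gf]] := seed_embedding_rcm hS' hS hemb.
exists g; split=> // c; elim=> {c} [|x xS|x [s []]|a b _ [a' Da <-] _ [b' Db <-]
  |a b _ [a' Da <-] _ [b' Db <-]].
- by exists 1; [exact: ca_one|exact: rcm_one rcm].
- have : x \in extended S by rewrite in_fsetU xS orbT.
  rewrite -(si_extended hf) => /imfsetP[y /= yS ->].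
  by exists y; [exact: cluster_algebra_variable|exact: gf].
- by case: s => [|y s] /=; rewrite trS in_fset0.
- have hr := rcm_ring_hom rcm inj.
  by exists (a' - b'); [exact: ca_sub|exact: (fh_B hr)].
- by exists (a' * b'); [exact: ca_mul|exact: (rcm_mul rcm)].
Qed.

Lemma proper_cluster_subalgebraP (F : fieldType) (S : seed F) (F' : fieldType)
    (S' : seed F') : is_seed S -> is_seed S' ->
  proper_cluster_subalgebra S' S <->
  exists I' I1 : {fset F},
    [/\ I' `<=` exch S, I1 `<=` extended S, I1 != fset0,
        {in I' & I1, forall x y, diag_unitization S x y = 0}
      & seed_isomorphic S' (sub_seed S (exch S `\` (I' `|` I1)) I1)].
Proof.
move=> hS hS'; split=> [[[f [rcm inj]] npure]|[I' [I1 [I'S I1S I1N zero [f hf]]]]].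
  have emb := rcm_seed_embedding (is_seed_regular hS') (is_seed_regular hS) rcm inj.
  have := embedding_seed_iso emb; set I' := f @` _; set I1 := _ `\` _.
  move=> /= [I'S I1S zero iso]; exists I', I1; split=> //; last by exists f.
  (* With [I1] empty, [f] would identify [S'] with a pure sub-seed. *)
  apply: contra_notN npure => /eqP I10; exists (exch S `\` (I' `|` I1)).
    exact: fsubsetDl.
  by exists f; move: iso; rewrite !I10.
have [g [rcm inj _]] := seed_embedding_rcm hS' hS (seed_iso_embedding I'S I1S zero hf).
split; first by exists g.
(* A pure sub-seed keeps all extended variables, while [I1] removes at least one, so the
   cardinalities differ. *)
move=> [I0 I0S [h hh]]; move: I1N; rewrite -cardfs_eq0.
have := seed_iso_card hf; rewrite (seed_iso_card hh) !extended_sub_seed ?fsubsetDl //.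
rewrite fsetD0 cardfsD (fsetIidPr I1S) => e.
have := fsubset_leq_card I1S; move: e; case: #|` I1| => // n.
case: #|` extended S| => // m; rewrite subSS => e.
by have := leq_subr n m; rewrite -e ltnn.
Qed.

Theorem corollary4p8 (F : fieldType) (S : seed F) (hS : is_seed S) :
  [/\ forall (F' : fieldType) (S' : seed F'), is_seed S' ->
        (proper_cluster_subalgebra S' S <->
         exists I' I1 : {fset F},
           [/\ I' `<=` exch S, I1 `<=` extended S, I1 != fset0,
               {in I' & I1, forall x y, diag_unitization S x y = 0}
             & seed_isomorphic S' (sub_seed S (exch S `\` (I' `|` I1)) I1)]),
      forall (F' : fieldType) (S' : seed F'), is_seed S' ->
        proper_cluster_subalgebra S' S ->
        (trivial S' <->
         exists I1 : {fset F},
           [/\ I1 `<=` extended S, I1 != fset0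
             & rooted_cluster_isomorphic S' (sub_seed S (exch S `\` I1) I1)]),
      (forall (F' : fieldType) (S' : seed F'), is_seed S' ->
         proper_cluster_subalgebra S' S -> trivial S') <->
      {in exch S & extended S, forall x y, diag_unitization S x y <> 0}
    & {in exch S & extended S, forall x y, diag_unitization S x y <> 0} ->
      forall (F' : fieldType) (S' : seed F'), is_seed S' ->
        ~ (proper_cluster_subalgebra S' S /\ ~ trivial S')].
Proof.
have nonzero_trivial : {in exch S & extended S, forall x y, diag_unitization S x y <> 0} ->
    forall (F' : fieldType) (S' : seed F'), is_seed S' ->
    proper_cluster_subalgebra S' S -> trivial S'.
  move=> nz F' S' hS' /(proper_cluster_subalgebraP hS hS').
  move=> [I' [I1 [I'S I1S /fset0Pn[y yI1] zero [f hf]]]].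
  apply/(seed_iso_trivial hf); rewrite /trivial exch_sub_seed //.
  (* An element [x] of [I'] would give a zero entry at [(x, y)]. *)
  apply/eqP; rewrite fsetD_eq0; apply/fsubsetP => x xI'.
  by case: (nz x y _ _ (zero x y xI' yI1));
    [exact: (fsubsetP I'S)|exact: (fsubsetP I1S)].
split.
- by move=> F' S' hS'; exact: proper_cluster_subalgebraP.
- move=> F' S' hS' /(proper_cluster_subalgebraP hS hS').
  move=> [I' [I1 [I'S I1S I1N zero [f hf]]]]; split=> [trS'|[J [JS JN [g [rcm inj _]]]]].
    exists I1; split=> //; have I'0 : I' `<=` I1.
      have := (seed_iso_trivial hf).1 trS'.
      by rewrite /trivial exch_sub_seed // => /eqP; rewrite fsetD_eq0.
    move: hf; rewrite (fsetUidPr _ _ I'0) => hf.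
    apply: seed_iso_trivial_rci hf trS' => //.
    by apply: sub_seed_is_seed => //; exact: fsubsetDl.
  have hT : is_seed (sub_seed S (exch S `\` J) J).
    by apply: sub_seed_is_seed => //; exact: fsubsetDl.
  have trT : exch (sub_seed S (exch S `\` J) J) = fset0.
    by apply/fsetP => z; rewrite /= !inE; case: (z \in J); case: (z \in exch S).
  (* An injective morphism keeps exchangeable variables exchangeable, and the target has none. *)
  apply/eqP/fset0Pn => -[x xS].
  have := rcm_exch (is_seed_regular hS') rcm inj xS.
  by rewrite trT in_fset0.
- split=> // h x y xS yS xy.
  have yx : y != x.
    by apply: contra_eqN xy => /eqP ->; rewrite /diag_unitization eqxx.
  (* The zero entry is itself a vanishing block. Being off the diagonal, it leaves [x] exchangeable
     in [T], which is therefore proper and non-trivial. *)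
  pose T := sub_seed S (exch S `\` ([fset x] `|` [fset y])) [fset y].
  have hT : is_seed T by apply: sub_seed_is_seed => //; exact: fsubsetDl.
  have xS1 : [fset x] `<=` exch S by rewrite fsub1set.
  have : trivial T.
    apply: (h F T hT); apply/(proper_cluster_subalgebraP hS hT).
    exists [fset x], [fset y]; split=> //.
    - by rewrite fsub1set.
    - by apply/fset0Pn; exists y; rewrite in_fset1.
    - by move=> _ _ /fset1P -> /fset1P ->.
    - exists id; split=> //; last 2 first.
      + by apply/fsetP => z; apply/imfsetP/idP => [[t /= tT ->] //|zT]; exists z.
      + by apply/fsetP => z; apply/imfsetP/idP => [[t /= tT ->] //|zT]; exists z.
      split=> // a b c d _ _ _ _ _.
      by rewrite mulr_ge0 // -expr2 sqr_ge0.
  rewrite /trivial exch_sub_seed // => /fsetP/(_ x).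
  by rewrite in_fsetD !in_fset1 eqxx eq_sym (negPf yx) in_fset0.
- by move=> nz F' S' hS' [pS' ntS']; apply: ntS'; exact: nonzero_trivial.
Qed.
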